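(* Let $N\ge 1$ and let $\mathcal{G}_N$ be the set of all real symmetric positive semi-definite $N\times N$ matrices $G$ with $G_{\mu\mu}=1$ for $\mu=1,\ldots,N$. Let $\mathsf{Aut}$ be the group of all affine bijections $\sigma:\mathcal{G}_N\to\mathcal{G}_N$, and let $\mathsf{Sym}$ be the subgroup of $\mathsf{Aut}$ generated by the maps $\Pi_\pi$ ($\pi\in S_N$) and $\mathsf{R}_{\mathcal T}$ ($\mathcal T\subseteq\{1,\ldots,N\}$) defined below. Then $\mathsf{Aut}=\mathsf{Sym}$.
   Context: For a permutation $\pi\in S_N$ let $U(\pi)$ be the $N\times N$ matrix with entries $U(\pi)_{\mu\nu}=\delta_{\mu,\pi(\nu)}$, and define $\Pi_\pi(G)=U(\pi)^{-1}GU(\pi)$, so that $\Pi_\pi(G)_{\mu\nu}=G_{\pi(\mu)\pi(\nu)}$. For a subset $\mathcal T\subseteq\{1,\ldots,N\}$ let $V_{\mathcal T}$ be the diagonal matrix with $(V_{\mathcal T})_{\mu\mu}=-1$ if $\mu\in\mathcal T$ and $+1$ otherwise, and define $\mathsf{R}_{\mathcal T}(G)=V_{\mathcal T}GV_{\mathcal T}$. Both kinds of maps are affine bijections of $\mathcal{G}_N$ onto itself. *)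

(* Defs.v *)
From HB Require Import structures.
From mathcomp Require Import all_boot all_order all_algebra all_fingroup.
From mathcomp Require Import reals.
Set Implicit Arguments. Unset Strict Implicit. Unset Printing Implicit Defensive.
Import Order.TTheory GRing.Theory Num.Theory.
Local Open Scope ring_scope.

Section Elliptope.
Variables (R : realType) (N : nat).

Definition symmetric_mx (G : 'M[R]_N) : Prop := G^T = G.
Definition psd_mx (G : 'M[R]_N) : Prop :=
  forall v : 'cV[R]_N, 0 <= (v^T *m G *m v) 0 0.
Definition elliptope (G : 'M[R]_N) : Prop :=
  [/\ symmetric_mx G, psd_mx G & forall mu : 'I_N, G mu mu = 1].

Definition Umx (pi : 'S_N) : 'M[R]_N := \matrix_(mu, nu) (mu == pi nu)%:R.
Definition Pimap (pi : 'S_N) (G : 'M[R]_N) : 'M[R]_N :=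
  invmx (Umx pi) *m G *m Umx pi.

Definition Vmx (T : {set 'I_N}) : 'M[R]_N :=
  \matrix_(mu, nu) (if mu == nu then (if mu \in T then -1 else 1) else 0).
Definition Rmap (T : {set 'I_N}) (G : 'M[R]_N) : 'M[R]_N :=
  Vmx T *m G *m Vmx T.

Definition affine_on (sigma : 'M[R]_N -> 'M[R]_N) : Prop :=
  forall (G1 G2 : 'M[R]_N) (t : R), elliptope G1 -> elliptope G2 ->
    0 <= t -> t <= 1 ->
    sigma (t *: G1 + (1 - t) *: G2) = t *: sigma G1 + (1 - t) *: sigma G2.

Definition bijection_on (sigma : 'M[R]_N -> 'M[R]_N) : Prop :=
  [/\ forall G, elliptope G -> elliptope (sigma G),
      forall G1 G2, elliptope G1 -> elliptope G2 -> sigma G1 = sigma G2 -> G1 = G2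
    & forall H, elliptope H -> exists2 G, elliptope G & sigma G = H].

(* the group generated by the Pi_pi and R_T (as maps; restricted to G_N later) *)
Inductive in_Sym : ('M[R]_N -> 'M[R]_N) -> Prop :=
| Sym_Pi pi : in_Sym (Pimap pi)
| Sym_R T : in_Sym (Rmap T)
| Sym_id : in_Sym id
| Sym_comp f g : in_Sym f -> in_Sym g -> in_Sym (f \o g)
| Sym_inv f g : in_Sym f -> cancel f g -> cancel g f -> in_Sym g.

End Elliptope.

(* Main.v *)
Require Import Defs.
From HB Require Import structures.
From mathcomp Require Import all_boot all_order all_algebra all_fingroup.
From mathcomp Require Import reals.
From mathcomp Require Import boolp.
From mathcomp Require Import ring lra.
Import Order.TTheory GRing.Theory Num.Theory.
Local Open Scope ring_scope.
Set Implicit Arguments.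
Unset Strict Implicit.
Unset Printing Implicit Defensive.

(** Write F_ij for the off-diagonal symmetric matrix with entries 1 at (i,j)
    and (j,i), and K_ij = sigma(I + F_ij) - sigma(I); then
    sigma(G) = sigma(I) + 1/2 sum_ij G_ij K_ij on the elliptope, and likewise
    for the inverse of sigma with matrices K'_ij.

    Orthogonality (the elliptope has a ball as its minimal ellipsoid).
    Averaging sigma(x x^T)_kl^2 <= 1 over all sign vectors x bounds
    |K|^2 + 2 |sigma(I)|^2; with the same bound for K' and the trace of the
    identity K'K = 1, this forces K' = K^T and sigma(I) = I.

    Edges go to edges. The quadratic form x^T K_ij x is bounded by 2 on sign
    vectors and has quadratic mean 2, so its square is constantly 4; hence the
    rows of K_ij are pairwise orthogonal. If all of them were shorter than 1,
    then I + t K_ij would be positive semi-definite for some t > 1, whereas its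
    preimage I + t F_ij is not. Since |K_ij|^2 = 2, this leaves only
    K_ij = +-F_kl.

    Assembling. Cut matrices x x^T go to cut matrices: the image of the
    all-ones matrix gives the switching, and the image of the cut with the
    single minus sign at a gives the vertex to which a is sent. *)

(** * Quadratic forms and basic points of the elliptope *)

Section QuadraticForms.
Variables (R : realType) (N : nat).
Implicit Types (A G : 'M[R]_N) (u : 'I_N -> R) (i j k : 'I_N).

Definition mxapp A u i : R := \sum_j A i j * u j.
Definition qform A u : R := \sum_i u i * mxapp A u i.
Definition shift u i (c : R) : 'I_N -> R := fun a => u a + c * (a == i)%:R.

Lemma sum_delta (f : 'I_N -> R) i : \sum_j f j * (j == i)%:R = f i.
Proof.
rewrite (bigD1 i) //= eqxx mulr1 big1 ?addr0 // => j /negPf ->.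
by rewrite mulr0.
Qed.

Lemma mxapp_shift A u i c j : mxapp A (shift u i c) j = mxapp A u j + c * A j i.
Proof.
rewrite -(sum_delta (A j) i) mulr_sumr -big_split /=.
by apply: eq_bigr => b _; rewrite /shift; ring.
Qed.

(** Iterated from the zero vector, this evaluates the form on short combinations of basis vectors;
    with [c = -2 * u i] it describes a sign flip. *)
Lemma qform_shift A u i c : A^T = A ->
  qform A (shift u i c) = qform A u + 2 * c * mxapp A u i + c ^+ 2 * A i i.
Proof.
move=> symA.
have rowE : mxapp A u i = \sum_a u a * A a i.
  by apply: eq_bigr => a _; rewrite -[in LHS]symA mxE mulrC.
rewrite /qform.
under eq_bigr => a _ do rewrite mxapp_shift.
have -> : \sum_a shift u i c a * (mxapp A u a + c * A a i) =
  \sum_a (u a * mxapp A u a + c * (u a * A a i) +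
     c * ((mxapp A u a + c * A a i) * (a == i)%:R)).
  by apply: eq_bigr => a _; rewrite /shift; ring.
rewrite !big_split /= -!mulr_sumr sum_delta rowE.
ring.
Qed.

Lemma mxapp0 A i : mxapp A (fun=> 0) i = 0.
Proof. by rewrite /mxapp big1 // => j _; rewrite mulr0. Qed.

Lemma qform0 A : qform A (fun=> 0) = 0.
Proof. by rewrite /qform big1 // => j _; rewrite mul0r. Qed.

Lemma mxapp1 u i : mxapp 1%:M u i = u i.
Proof.
rewrite -[RHS](sum_delta u i); apply: eq_bigr => j _.
by rewrite mxE eq_sym mulrC.
Qed.

Lemma qformE A (v : 'cV[R]_N) : (v^T *m A *m v) 0 0 = qform A (v^~ 0).
Proof.
rewrite -mulmxA mxE; apply: eq_bigr => i _; rewrite !mxE.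
by congr (_ * _).
Qed.

Lemma elliptopeP G : elliptope G <->
  [/\ G^T = G, forall u, 0 <= qform G u & forall i, G i i = 1].
Proof.
split=> -[symG psdG diagG]; split=> // u; last by rewrite qformE.
have := psdG (\col_i u i); rewrite qformE.
congr (0 <= _); apply: eq_bigr => i _; rewrite mxE; congr (_ * _).
by apply: eq_bigr => j _; rewrite mxE.
Qed.

Lemma elliptope_sym G i j : elliptope G -> G i j = G j i.
Proof. by case=> symG _ _; rewrite -[in LHS]symG mxE. Qed.

(** The form is non-negative at [e_j + e_i] and [e_j - e_i]. *)
Lemma elliptope_entry G i j : elliptope G -> -1 <= G i j <= 1.
Proof.
move=> /elliptopeP[symG psdG diagG].
have H c : 0 <= 1 + 2 * c * G i j + c ^+ 2.
  have := psdG (shift (shift (fun=> 0) j 1) i c).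
  rewrite !qform_shift // !mxapp_shift !mxapp0 qform0 !diagG.
  by congr (0 <= _); ring.
have H1 := H 1; have H2 := H (-1); lra.
Qed.

Lemma elliptope_entry_sqr G i j : elliptope G -> G i j ^+ 2 <= 1.
Proof. by move=> /(elliptope_entry i j) /andP[*]; nra. Qed.

(** In a Gram representation by unit vectors, [G i j = 1] or [-1] makes vectors [i] and [j] equal up
    to that sign. *)
Lemma elliptope_sign_trans G i j k : elliptope G ->
  G i j ^+ 2 = 1 -> G i k = G i j * G j k.
Proof.
move=> eG Gij; have Gji : G j i = G i j by apply: elliptope_sym.
have Gki : G k i = G i k by apply: elliptope_sym.
have Gkj : G k j = G j k by apply: elliptope_sym.
move/elliptopeP: eG => [symG psdG diagG].
pose d := G i k - G i j * G j k.
(* The vector [e_i - G_ij e_j] is isotropic, hence in the kernel of [G]. *)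
have := psdG (shift (shift (shift (fun=> 0) i 1) j (- G i j)) k (- d)).
rewrite !qform_shift // !mxapp_shift !mxapp0 qform0 !diagG Gki Gkj Gji.
have -> : 0 + 2 * 1 * 0 + 1 ^+ 2 * 1 + 2 * - G i j * (0 + 1 * G i j) +
  (- G i j) ^+ 2 * 1 + 2 * - d * (0 + 1 * G i k + - G i j * G j k) +
  (- d) ^+ 2 * 1 = 1 - G i j ^+ 2 - d ^+ 2 by rewrite /d; ring.
rewrite Gij subrr sub0r oppr_ge0 => d2.
have : d ^+ 2 = 0 by apply/eqP; rewrite eq_le d2 sqr_ge0.
by move/eqP; rewrite sqrf_eq0 subr_eq0 => /eqP.
Qed.

Lemma qform1D A u : qform (1%:M + A) u = \sum_i u i ^+ 2 + qform A u.
Proof.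
rewrite -big_split; apply: eq_bigr => i _ /=; rewrite -[in RHS]mulrDr.
congr (_ * _); rewrite -[X in _ = X + _]mxapp1 -big_split.
by apply: eq_bigr => j _ /=; rewrite !mxE -mulrDl.
Qed.

(* [0 <= |u + A u|^2 <= 2 (|u|^2 + <u, A u>)] *)
Lemma elliptope_contraction A : A^T = A -> (forall i, A i i = 0) ->
  (forall u, \sum_i mxapp A u i ^+ 2 <= \sum_i u i ^+ 2) ->
  elliptope (1%:M + A).
Proof.
move=> symA diagA leA; apply/elliptopeP; split=> [|u|i]; last first.
- by rewrite !mxE eqxx diagA addr0.
- rewrite qform1D.
  have : 0 <= \sum_i (u i + mxapp A u i) ^+ 2.
    by apply: sumr_ge0 => i _; apply: sqr_ge0.
  have -> : \sum_i (u i + mxapp A u i) ^+ 2 =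
      \sum_i u i ^+ 2 + 2 * qform A u + \sum_i mxapp A u i ^+ 2.
    by rewrite mulr_sumr -!big_split; apply: eq_bigr => i _ /=; ring.
  have := leA u; lra.
- by rewrite linearD /= trmx1 symA.
Qed.

Lemma elliptope1 : elliptope (1%:M : 'M[R]_N).
Proof.
rewrite -[1%:M]addr0; apply: elliptope_contraction => [|i|u].
- by rewrite trmx0.
- by rewrite mxE.
apply: ler_sum => i _; rewrite /mxapp big1 ?expr0n ?sqr_ge0 //.
by move=> j _; rewrite mxE mul0r.
Qed.

Lemma elliptope_conv G H (t : R) : elliptope G -> elliptope H ->
  0 <= t -> t <= 1 -> elliptope (t *: G + (1 - t) *: H).
Proof.
move=> /elliptopeP[symG psdG diagG] /elliptopeP[symH psdH diagH] t0 t1.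
apply/elliptopeP; split=> [|u|i]; last first.
- by rewrite !mxE diagG diagH; ring.
- have -> : qform (t *: G + (1 - t) *: H) u =
     t * qform G u + (1 - t) * qform H u.
    rewrite !mulr_sumr -big_split; apply: eq_bigr => i _ /=.
    rewrite !(mulrCA _ (u i)) -mulrDr; congr (_ * _).
    rewrite !mulr_sumr -big_split; apply: eq_bigr => j _ /=.
    by rewrite !mxE; ring.
  by rewrite addr_ge0 // mulr_ge0 // subr_ge0.
- by rewrite linearD /= !linearZ /= symG symH.
Qed.

(** The value 0 for [i = j] lets sums run over all ordered pairs without side conditions and keeps
    [1%:M + t *: edge_mx i j] in the elliptope. *)
Definition edge_mx i j : 'M[R]_N :=
  \matrix_(a, b) if i == j then 0
                 else ((a == i) && (b == j))%:R + ((a == j) && (b == i))%:R.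

Lemma edge_mxC i j : edge_mx i j = edge_mx j i.
Proof. by apply/matrixP=> a b; rewrite !mxE eq_sym addrC. Qed.

Lemma edge_mx_sym i j : (edge_mx i j)^T = edge_mx i j.
Proof.
by apply/matrixP=> a b; rewrite !mxE addrC ![(b == _) && _]andbC.
Qed.

Lemma edge_mx_diag i j a : edge_mx i j a a = 0.
Proof.
rewrite mxE; case: ifPn => // nij.
have [->|_] := eqVneq a i; first by rewrite (negPf nij) addr0.
by rewrite andbF addr0.
Qed.

Lemma edge_mxii i : edge_mx i i = 0.
Proof. by apply/matrixP=> a b; rewrite !mxE eqxx. Qed.

(** The ordered pairs [(a, b)] and [(b, a)] both contribute, which is the origin of the factors
    [2^-1] in later expansions. *)
Lemma sum_edge_mx A a b : A^T = A -> a != b ->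
  \sum_i \sum_j A i j * edge_mx i j a b = 2 * A a b.
Proof.
move=> symA nab.
have -> : \sum_i \sum_j A i j * edge_mx i j a b =
  \sum_i (\sum_j (A i j * (j == b)%:R)) * (i == a)%:R +
  \sum_i (\sum_j (A i j * (j == a)%:R)) * (i == b)%:R.
  rewrite -big_split; apply: eq_bigr => i _ /=.
  rewrite !mulr_suml -big_split; apply: eq_bigr => j _ /=.
  rewrite mxE; case: eqP => [<-|_].
    have [->|_] := eqVneq i a; first by rewrite (negPf nab) !(mulr0, mul0r, addr0).
    by rewrite !(mulr0, mul0r) addr0.
  by rewrite !(eq_sym _ i) !(eq_sym _ j) -!mulnb !natrM; ring.
rewrite !sum_delta.
have -> : A b a = A a b by rewrite -[in LHS]symA mxE.
ring.
Qed.

Lemma mxapp_edge (t : R) i j u a : i != j ->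
  mxapp (t *: edge_mx i j) u a = t * (u j * (a == i)%:R + u i * (a == j)%:R).
Proof.
move=> nij; rewrite -(sum_delta u i) -(sum_delta u j) !mulr_suml.
rewrite -big_split mulr_sumr; apply: eq_bigr => b _ /=.
by rewrite !mxE (negPf nij) -!mulnb !natrM; ring.
Qed.

(** The edge matrix swaps coordinates [i] and [j] and kills all others, so multiplied by [t] it is a
    contraction. *)
Lemma elliptope_edge (t : R) i j : -1 <= t <= 1 ->
  elliptope (1%:M + t *: edge_mx i j).
Proof.
move=> /andP[t1 t2].
have [->|nij] := eqVneq i j.
  by rewrite edge_mxii scaler0 addr0; apply: elliptope1.
apply: elliptope_contraction => [|a|u].
- by rewrite linearZ /= edge_mx_sym.
- by rewrite mxE edge_mx_diag mulr0.
have -> : \sum_a mxapp (t *: edge_mx i j) u a ^+ 2 =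
    t ^+ 2 * (u j ^+ 2 + u i ^+ 2).
  rewrite -(sum_delta (fun=> u j ^+ 2) i) -(sum_delta (fun=> u i ^+ 2) j).
  rewrite -big_split mulr_sumr; apply: eq_bigr => a _ /=.
  rewrite mxapp_edge //; case: (eqVneq a i) => [->|_].
    by rewrite (negPf nij) /=; ring.
  by case: (a == j) => /=; ring.
rewrite (bigD1 i) //= (bigD1 j) 1?eq_sym //=.
have : 0 <= \sum_(a | (a != i) && (a != j)) u a ^+ 2.
  by apply: sumr_ge0 => a _; apply: sqr_ge0.
have tt : t ^+ 2 <= 1 by nra.
have := ler_piMl (addr_ge0 (sqr_ge0 (u j)) (sqr_ge0 (u i))) tt; lra.
Qed.

Lemma elliptope_edge1 i j : elliptope (1%:M + edge_mx i j).
Proof. by rewrite -[edge_mx i j]scale1r; apply: elliptope_edge; lra. Qed.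

End QuadraticForms.

(** * Averages over sign vectors *)

Section SignVectors.
Variables (R : realType) (N : nat).
Local Notation cube := {ffun 'I_N -> bool}.
Implicit Types (A : 'M[R]_N) (x : cube) (i j : 'I_N).

Definition sgv x i : R := (-1) ^+ x i.
Definition flip i x : cube := [ffun k => if k == i then ~~ x k else x k].
Definition cut_mx x : 'M[R]_N := \matrix_(i, j) (sgv x i * sgv x j).

Lemma sgv_sqr x i : sgv x i ^+ 2 = 1.
Proof. by rewrite /sgv sqrr_sign. Qed.

Lemma flipK i : involutive (flip i).
Proof.
by move=> x; apply/ffunP=> k; rewrite !ffunE; case: eqP => // _; apply: negbK.
Qed.

Lemma sum_flip i (f : cube -> R) : \sum_x f x = \sum_x f (flip i x).
Proof. exact: (reindex_inj (inv_inj (flipK i))). Qed.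

Lemma sgv_flip i x : sgv (flip i x) = shift (sgv x) i (-2 * sgv x i).
Proof.
apply/funext => k; rewrite /shift /sgv ffunE; case: eqP => [->|_]; last first.
  by rewrite mulr0 addr0.
by rewrite signrN mulr1; ring.
Qed.

(** Flipping coordinate [i] permutes the cube and negates every term. *)
Lemma sum_sgv2 i j : i != j -> \sum_x sgv x i * sgv x j = 0.
Proof.
move=> nij; set S := \sum_x _; suff : S = - S by lra.
rewrite [LHS](sum_flip i) -sumrN; apply: eq_bigr => x _.
by rewrite sgv_flip /shift eqxx eq_sym (negPf nij) mulr0 mulr1; ring.
Qed.

(** Distinct coordinates are orthogonal on the cube, so this average extracts one coefficient of a
    linear form. *)
Lemma sum_sgv_mxapp A i j :
  \sum_x sgv x j * mxapp A (sgv x) i = #|{: cube}|%:R * A i j.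
Proof.
transitivity (\sum_k A i k * \sum_x sgv x j * sgv x k).
  under eq_bigr => x _ do rewrite mulr_sumr.
  rewrite exchange_big; apply: eq_bigr => k _; rewrite mulr_sumr.
  by apply: eq_bigr => x _; ring.
rewrite (bigD1 j) //= [X in _ + X]big1 ?addr0 => [|k nkj]; last first.
  by rewrite sum_sgv2 ?mulr0 // eq_sym.
rewrite mulrC; congr (_ * _).
under eq_bigr => x _ do rewrite -expr2 sgv_sqr.
by rewrite sumr_const.
Qed.

Section ZeroDiagonal.
Variable A : 'M[R]_N.
Hypotheses (symA : A^T = A) (diagA : forall i, A i i = 0).

Lemma sum_qform_sgv : \sum_x qform A (sgv x) = 0.
Proof.
rewrite exchange_big big1 // => i _.
by rewrite sum_sgv_mxapp diagA mulr0.
Qed.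

Lemma qform_flip i x :
  qform A (sgv (flip i x)) =
  qform A (sgv x) - 4 * (sgv x i * mxapp A (sgv x) i).
Proof. by rewrite sgv_flip qform_shift // diagA; ring. Qed.

(** Up to the size of the cube, this is the Fourier coefficient of the form at [x_i x_j]; the flip
    of [i] gives a linear equation for the sum. *)
Lemma sum_sgv2_qform i j : i != j ->
  \sum_x sgv x i * sgv x j * qform A (sgv x) = 2 * #|{: cube}|%:R * A i j.
Proof.
move=> nij; set S := \sum_x _.
suff : S = - S + 4 * (#|{: cube}|%:R * A i j) by lra.
rewrite [LHS](sum_flip i) -sum_sgv_mxapp mulr_sumr -sumrN -big_split.
apply: eq_bigr => x _ /=; rewrite qform_flip sgv_flip /shift eqxx eq_sym.
rewrite (negPf nij) mulr0 mulr1 addr0.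
by have := sgv_sqr x i => s2; ring: s2.
Qed.

(** Parseval's identity for a quadratic form on the cube. *)
Lemma sum_qform_sgv_sqr :
  \sum_x qform A (sgv x) ^+ 2 =
  2 * #|{: cube}|%:R * \sum_i \sum_j A i j ^+ 2.
Proof.
transitivity (\sum_i \sum_j A i j *
    \sum_x sgv x i * sgv x j * qform A (sgv x)).
  under eq_bigr => x _ do rewrite expr2 {1}/qform mulr_suml.
  rewrite exchange_big; apply: eq_bigr => i _ /=.
  under eq_bigr => x _ do rewrite mulrAC mulr_sumr.
  rewrite exchange_big; apply: eq_bigr => j _ /=.
  by rewrite mulr_sumr; apply: eq_bigr => x _; ring.
rewrite mulr_sumr; apply: eq_bigr => i _; rewrite mulr_sumr.
apply: eq_bigr => j _; have [<-|nij] := eqVneq i j.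
  by rewrite diagA expr0n mulr0 mul0r.
by rewrite sum_sgv2_qform //; ring.
Qed.

(* Flipping the coordinates [i] and [j] one by one and jointly does not change
   [q^2]; the mixed second difference of [q^2] expresses [(A x)_i (A x)_j]
   through terms of zero mean. *)
Lemma rows_orthogonal i j :
  (forall x, qform A (sgv x) ^+ 2 = 4) -> i != j ->
  \sum_k A i k * A j k = 0.
Proof.
move=> q4 nij.
have C0 : (#|{: cube}|%:R : R) != 0.
  by rewrite pnatr_eq0 -lt0n; apply/card_gt0P; exists [ffun=> false].
apply: (mulfI C0); rewrite mulr0 mulr_sumr.
under eq_bigr => k _ do rewrite mulrCA -sum_sgv_mxapp mulr_sumr.
rewrite exchange_big /=.
transitivity (\sum_x (- (A i j / 2) * qform A (sgv x)
   + - 2 * A i j ^+ 2 * (sgv x i * sgv x j)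
   + 2 * A i j * (sgv x i * mxapp A (sgv x) i)
   + 2 * A i j * (sgv x j * mxapp A (sgv x) j))); last first.
  rewrite !big_split /= -!mulr_sumr sum_qform_sgv sum_sgv2 // !sum_sgv_mxapp.
  by rewrite !diagA; ring.
apply: eq_bigr => x _.
under eq_bigr => k _ do rewrite mulrA.
rewrite -mulr_suml -/(mxapp A (sgv x) i).
set gi := mxapp A (sgv x) i; set gj := mxapp A (sgv x) j.
have q1 := q4 x; have := q4 (flip i x); have := q4 (flip j x).
have := q4 (flip j (flip i x)); rewrite !qform_flip sgv_flip mxapp_shift.
rewrite /shift [j == i]eq_sym (negPf nij) mulr0 addr0 -/gi -/gj.
have -> : A j i = A i j by rewrite -[in LHS]symA mxE.
have si := sgv_sqr x i; have sj := sgv_sqr x j.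
move: q1; set q := qform _ _; set a := sgv x i in si *.
set b := sgv x j in sj *; set m := A i j => q1 q2 q3 q5.
have E : a * gi * (b * gj) = - (q / 2) * (m * a * b) - 2 * (m * a * b) ^+ 2
    + 2 * (a * gi) * (m * a * b) + 2 * (b * gj) * (m * a * b) by lra.
have -> : gi * gj = a * b * (a * gi * (b * gj)) by ring: si sj.
by rewrite E; field: si sj.
Qed.

End ZeroDiagonal.
End SignVectors.

(** * Symmetric matrices with orthogonal rows *)

Section OrthogonalRows.
Variables (R : realType) (N : nat) (M : 'M[R]_N).
Hypotheses (symM : M^T = M) (diagM : forall i, M i i = 0).
Hypothesis orthoM : forall i j, i != j -> \sum_k M i k * M j k = 0.

(** By symmetry and orthogonality of the rows, [M *m M] is diagonal, with the squared row norms on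
    its diagonal. *)
Lemma sum_mxapp_sqr u :
  \sum_k mxapp M u k ^+ 2 = \sum_i u i ^+ 2 * \sum_k M i k ^+ 2.
Proof.
have rowC i j : M i j = M j i by rewrite -[in LHS]symM mxE.
transitivity (\sum_i \sum_j u i * u j * \sum_k M i k * M j k).
  transitivity (\sum_k \sum_i \sum_j u i * u j * (M i k * M j k)).
    apply: eq_bigr => k _; rewrite expr2 {1}/mxapp mulr_suml.
    apply: eq_bigr => i _; rewrite /mxapp mulr_sumr; apply: eq_bigr => j _.
    by rewrite (rowC k i) (rowC k j); ring.
  rewrite exchange_big; apply: eq_bigr => i _ /=.
  rewrite exchange_big; apply: eq_bigr => j _ /=.
  by rewrite mulr_sumr.
apply: eq_bigr => i _.
rewrite (bigD1 i) //= [X in _ + X]big1 ?addr0 => [|j nji].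
  by rewrite -expr2; congr (_ * _); apply: eq_bigr => k _; rewrite expr2.
by rewrite orthoM ?mulr0 // eq_sym.
Qed.

Lemma elliptope_dilation :
  (forall i, \sum_k M i k ^+ 2 < 1) ->
  exists2 t : R, 1 < t & elliptope (1%:M + t *: M).
Proof.
move=> lt1.
have [d d1 dP] : exists2 d : R, d < 1 & forall i, \sum_k M i k ^+ 2 <= d.
  pose d := \big[Order.max/0]_i \sum_k M i k ^+ 2.
  exists d; first by apply/bigmax_ltP; split=> // i _; apply: lt1.
  by move=> i; apply: le_bigmax.
(* A negative bound on squared norms means that there are no rows, so any [t > 1] will do. *)
have [d0|d0] := ltrP d 0.
  exists 2; first by lra.
  apply: elliptope_contraction => [|i|u].
  - by rewrite linearZ /= symM.
  - by rewrite mxE diagM mulr0.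
  apply: ler_sum => i _; exfalso.
  have := le_trans (sumr_ge0 _ (fun k _ => sqr_ge0 (M i k))) (dP i); lra.
have p : 0 < 1 + d by lra.
(* A rational substitute for the inverse square root of [d]: [t ^+ 2 * d <= 1] amounts to
   [4 * d <= (1 + d) ^+ 2]. *)
pose t := 2 / (1 + d); have tE : t * (1 + d) = 2 by rewrite divfK // gt_eqF.
have t1 : 1 < t by rewrite ltr_pdivlMr //; lra.
have td : t ^+ 2 * d <= 1.
  have : 0 <= (t * (1 - d)) ^+ 2 by apply: sqr_ge0.
  have : (t * (1 + d)) ^+ 2 = 4 by rewrite tE; ring.
  nra.
exists t => //; apply: elliptope_contraction => [|i|u].
- by rewrite linearZ /= symM.
- by rewrite mxE diagM mulr0.
have -> : \sum_i mxapp (t *: M) u i ^+ 2 = t ^+ 2 * \sum_i mxapp M u i ^+ 2.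
  rewrite mulr_sumr; apply: eq_bigr => i _; rewrite -exprMn; congr (_ ^+ 2).
  by rewrite mulr_sumr; apply: eq_bigr => j _; rewrite mxE mulrA.
rewrite sum_mxapp_sqr mulr_sumr; apply: ler_sum => i _.
rewrite mulrCA ler_piMr ?sqr_ge0 //.
by apply: le_trans td; rewrite ler_wpM2l ?sqr_ge0.
Qed.

(** Row [k] and column [k] already use up the total squared norm 2, so all other entries vanish;
    orthogonality then leaves a single entry in row [k]. *)
Lemma edge_of_orthogonal_rows k :
  \sum_i \sum_j M i j ^+ 2 = 2 -> 1 <= \sum_j M k j ^+ 2 ->
  exists l, exists2 s : R, k != l & s ^+ 2 = 1 /\ M = s *: edge_mx R k l.
Proof.
move=> norm2 rowk.
have MC i j : M i j = M j i by rewrite -[in LHS]symM mxE.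
pose S := \sum_(i | i != k) \sum_(j | j != k) M i j ^+ 2.
have S0 : 0 <= S.
  by apply: sumr_ge0 => i _; apply: sumr_ge0 => j _; apply: sqr_ge0.
(* Row [k] and column [k] have equal norms and meet only in a zero diagonal entry. *)
have normE : 2 * (\sum_j M k j ^+ 2) + S = 2.
  rewrite -[RHS]norm2 [RHS](bigD1 k) //= mulr_natl mulr2n -addrA; congr (_ + _).
  rewrite [LHS]addrC; under [RHS]eq_bigr => i _ do rewrite (bigD1 k) //=.
  rewrite big_split /= addrC; congr (_ + _).
  rewrite (bigD1 k) //= diagM expr0n add0r.
  by apply: eq_bigr => i _; rewrite MC.
have rowk1 : \sum_j M k j ^+ 2 = 1 by lra.
have {}S0 : S = 0 by lra.
have M0 i j : i != k -> j != k -> M i j = 0.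
  move=> ik jk; apply/eqP; rewrite -sqrf_eq0; apply/eqP.
  move/psumr_eq0P: S0 => /(_ (fun i _ => sumr_ge0 _ (fun j _ => sqr_ge0 _))).
  by move=> /(_ i ik) /psumr_eq0P-> // ? _; apply: sqr_ge0.
have [l Mkl] : exists l, M k l != 0.
  apply/existsP; apply: contra_eqT rowk1 => /existsPn Mk0.
  rewrite big1 1?eq_sym ?oner_eq0 // => j _.
  by have := Mk0 j; rewrite negbK => /eqP->; rewrite expr0n.
have nkl : k != l by apply: contraNneq Mkl => <-; rewrite diagM.
have Mk j : j != l -> M k j = 0.
  move=> jl; have [->|jk] := eqVneq j k; first by rewrite diagM.
  (* Rows [j] and [l] live in column [k] only, so their inner product is the single product
     [M j k * M l k]. *)
  have := orthoM jl; rewrite (bigD1 k) //= big1 ?addr0 => [/eqP|a ak].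
    by rewrite mulf_eq0 ![M _ k]MC (negPf Mkl) orbF => /eqP.
  by rewrite M0 ?mul0r.
exists l, (M k l) => //; split.
  rewrite -rowk1 (bigD1 l) //= big1 ?addr0 // => j jl.
  by rewrite Mk ?expr0n.
apply/matrixP=> a b; rewrite !mxE (negPf nkl).
have [->|ak] := eqVneq a k; have [->|bl] := eqVneq b l => /=.
- by rewrite (negPf nkl) addr0 mulr1.
- by rewrite Mk // (negPf nkl) addr0 mulr0.
- have nlk : l != k by rewrite eq_sym.
  by rewrite (negPf nlk) andbF addr0 M0 // mulr0.
- have [->|bk] := eqVneq b k; last by rewrite M0 ?andbF ?addr0 ?mulr0.
  rewrite andbT add0r MC; have [->|al] := eqVneq a l; first by rewrite mulr1.
  by rewrite Mk ?mulr0.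
Qed.

End OrthogonalRows.

(** * Expansion of an affine map along the edge matrices *)

Section AffineMaps.
Variables (R : realType) (N : nat) (sigma : 'M[R]_N -> 'M[R]_N).
Hypothesis aff : affine_on sigma.

(** Passes from two-point convex combinations to finite averages. Membership is proved in the same
    induction because [affine_on] requires both points to lie in the elliptope. *)
Lemma affine_on_avg (I : Type) (s : seq I) (F : I -> 'M[R]_N) :
  s <> [::] -> (forall p, elliptope (F p)) ->
  elliptope ((size s)%:R^-1 *: \sum_(p <- s) F p) /\
  sigma ((size s)%:R^-1 *: \sum_(p <- s) F p) =
  (size s)%:R^-1 *: \sum_(p <- s) sigma (F p).
Proof.
move=> + eF; case: s => [//|p s _].
elim: s p => [|p' s IHs] p; first by rewrite !big_seq1 /= invr1 !scale1r.
have [eA sA] := IHs p'; move: eA sA.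
set r := p' :: s; set n : R := (size r)%:R => eA sA.
have n0 : 0 < n by rewrite ltr0n.
(* The head gets weight [(1 + n)^-1], the average of the tail the remaining weight. *)
have E (H : I -> 'M[R]_N) :
  (size (p :: r))%:R^-1 *: \sum_(p0 <- p :: r) H p0 =
  (1 + n)^-1 *: H p + (1 - (1 + n)^-1) *: (n^-1 *: \sum_(p0 <- r) H p0).
  have -> : (size (p :: r))%:R = 1 + n by rewrite /= -natr1 addrC.
  rewrite big_cons scalerDr scalerA; congr (_ + _ *: _).
  by field; rewrite !gt_eqF //; lra.
have t0 : 0 <= (1 + n)^-1 by rewrite invr_ge0; lra.
have t1 : (1 + n)^-1 <= 1 by rewrite invf_le1; lra.
by rewrite !E aff // sA; split=> //; apply: elliptope_conv.
Qed.

Definition edge_img i j : 'M[R]_N := sigma (1%:M + edge_mx R i j) - sigma 1%:M.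

Lemma edge_imgC i j : edge_img i j = edge_img j i.
Proof. by rewrite /edge_img edge_mxC. Qed.

Lemma edge_imgii i : edge_img i i = 0.
Proof. by rewrite /edge_img edge_mxii addr0 subrr. Qed.

(** The identity is the midpoint of [1%:M + E] and [1%:M - E], which determines [sigma] at the
    second point and so settles negative [t]. *)
Lemma sigma_edge (t : R) i j : -1 <= t <= 1 ->
  sigma (1%:M + t *: edge_mx R i j) = sigma 1%:M + t *: edge_img i j.
Proof.
move=> /andP[t1 t2]; set E := edge_mx R i j.
have e1 := @elliptope1 R N.
have eP : elliptope (1%:M + E) := elliptope_edge1 R i j.
have eM : elliptope (1%:M - E).
  by rewrite -scaleN1r; apply: elliptope_edge; lra.
have sM : sigma (1%:M - E) = sigma 1%:M - edge_img i j.
  have := @aff _ _ 2^-1 eP eM; rewrite invr_ge0 invf_le1 // => /(_ _ _).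
  have -> : 2^-1 *: (1%:M + E) + (1 - 2^-1) *: (1%:M - E) = 1%:M :> 'M[R]_N.
    by apply/matrixP=> a b; rewrite !mxE; field.
  move=> H; have {H} := H ltac:(lra) ltac:(lra) => H.
  apply/matrixP=> a b; move/matrixP/(_ a b): H.
  by rewrite /edge_img !mxE; lra.
have [t0|t0] := lerP 0 t.
  have := aff eP e1 t0 t2.
  have -> : t *: (1%:M + E) + (1 - t) *: 1%:M = 1%:M + t *: E.
    by apply/matrixP=> a b; rewrite !mxE; ring.
  by move->; apply/matrixP=> a b; rewrite !mxE; ring.
have := @aff _ _ (- t) eM e1.
have -> : - t *: (1%:M - E) + (1 - - t) *: 1%:M = 1%:M + t *: E.
  by apply/matrixP=> a b; rewrite !mxE; ring.
move=> ->; [rewrite sM | lra | lra].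
by apply/matrixP=> a b; rewrite !mxE; ring.
Qed.

(** As [sigma] is affine only on the elliptope, one point is computed twice: as the average of the
    points [F p] over all [n] ordered pairs, and as a point of the segment from [1%:M] to [G]. *)
Lemma affine_on_edges G : (1 <= N)%N -> elliptope G ->
  sigma G = sigma 1%:M + 2^-1 *: \sum_i \sum_j G i j *: edge_img i j.
Proof.
move=> N0 eG.
pose s := index_enum ('I_N * 'I_N)%type.
pose F (p : 'I_N * 'I_N) : 'M[R]_N :=
  1%:M + (2^-1 * G p.1 p.2) *: edge_mx R p.1 p.2.
have s0 : s <> [::].
  move=> s0; have : (Ordinal N0, Ordinal N0) \in s by rewrite mem_index_enum.
  by rewrite s0.
have half i j : -1 <= 2^-1 * G i j <= 1.
  by have /andP[] := elliptope_entry i j eG; lra.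
have eF p : elliptope (F p) by apply: elliptope_edge.
have [_] := affine_on_avg s0 eF.
have n0 : (0 < size s)%N by case: (s) s0.
set n : R := (size s)%:R.
have n1 : 1 <= n by rewrite ler1n.
have nN0 : n != 0 by rewrite gt_eqF //; lra.
have avgE (S : 'M[R]_N) (H : 'I_N -> 'I_N -> 'M[R]_N) :
    n^-1 *: \sum_(p <- s) (S + (2^-1 * G p.1 p.2) *: H p.1 p.2) =
    S + n^-1 *: (2^-1 *: \sum_i \sum_j G i j *: H i j).
  rewrite big_split /= scalerDr; congr (_ + _ *: _).
    rewrite big_const_seq count_predT iter_addr_0 -scaler_nat scalerA mulVf //.
    by rewrite scale1r.
  rewrite pair_big scaler_sumr; apply: eq_bigr => p _ /=.
  by rewrite scalerA.
have -> : \sum_(p <- s) sigma (F p) = \sum_(p <- s)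
    (sigma 1%:M + (2^-1 * G p.1 p.2) *: edge_img p.1 p.2).
  by apply: eq_bigr => p _; apply: sigma_edge.
rewrite !avgE.
have [symG _ diagG] := eG.
have -> : 2^-1 *: \sum_i \sum_j G i j *: edge_mx R i j = G - 1%:M.
  apply/matrixP=> a b; rewrite mxE summxE.
  under eq_bigr => i _ do rewrite summxE.
  under eq_bigr => i _ do under eq_bigr => j _ do rewrite mxE.
  have [<-|nab] := eqVneq a b.
    rewrite !mxE eqxx diagG subrr big1 ?mulr0 // => i _.
    by rewrite big1 // => j _; rewrite edge_mx_diag mulr0.
  by rewrite sum_edge_mx // !mxE (negPf nab) subr0 mulKf ?pnatr_eq0.
(* The average of the [F p], rewritten as a convex combination of [G] and the identity. *)
have -> : 1%:M + n^-1 *: (G - 1%:M) = n^-1 *: G + (1 - n^-1) *: 1%:M.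
  by apply/matrixP=> a b; rewrite !mxE; ring.
have n1i : n^-1 <= 1 by rewrite invf_le1 //; lra.
rewrite aff //; [|exact: elliptope1|by rewrite invr_ge0; lra].
rewrite scalerBl scale1r => H.
apply: (scalerI (invr_neq0 nN0)); rewrite scalerDr.
have {}H := congr1 (fun A => A - sigma 1%:M + n^-1 *: sigma 1%:M) H.
move: H; set X := _ *: \sum_i _; set S := sigma 1%:M.
by move=> H; apply/matrixP=> a b; move/matrixP/(_ a b): H; rewrite !mxE; lra.
Qed.

End AffineMaps.

(** * Cut matrices *)

Section CutMatrices.
Variables (R : realType) (N : nat).
Local Notation cube := {ffun 'I_N -> bool}.

Lemma elliptope_cut (x : cube) : elliptope (cut_mx R x).
Proof.
apply/elliptopeP; split=> [|u|i].
- by apply/matrixP=> i j; rewrite !mxE mulrC.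
- have -> : qform (cut_mx R x) u = (\sum_i u i * sgv R x i) ^+ 2.
    rewrite expr2 mulr_suml; apply: eq_bigr => i _; rewrite -mulrA.
    congr (_ * _); rewrite mulr_sumr; apply: eq_bigr => j _.
    by rewrite mxE; ring.
  exact: sqr_ge0.
- by rewrite mxE -expr2 sgv_sqr.
Qed.

Lemma sum_cut_mx (x y : cube) :
  \sum_i \sum_j cut_mx R x i j * cut_mx R y i j =
  (\sum_i sgv R x i * sgv R y i) ^+ 2.
Proof.
rewrite expr2 mulr_suml; apply: eq_bigr => i _; rewrite mulr_sumr.
by apply: eq_bigr => j _; rewrite !mxE; ring.
Qed.

(** Row [k] serves as the sign vector, since [G i j = G i k * G k j] when all entries are signs. *)
Lemma cut_of_signs (G : 'M[R]_N) (k : 'I_N) : elliptope G ->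
  (forall i j, G i j ^+ 2 = 1) -> exists x : cube, G = cut_mx R x.
Proof.
move=> eG G2; exists [ffun i => G k i < 0]; apply/matrixP=> i j.
have sgE a : sgv R [ffun i => G k i < 0] a = G k a.
  rewrite /sgv ffunE; case: ltrP (G2 k a) => s /eqP; rewrite sqrf_eq1.
    by case/orP => /eqP E; rewrite E in s *; lra.
  by case/orP => /eqP E; rewrite E in s *; rewrite ?expr0 //; lra.
rewrite mxE !sgE (elliptope_sign_trans j eG (G2 i k)).
by rewrite (elliptope_sym i k).
Qed.

End CutMatrices.

(** * The norm bound behind the minimal ellipsoid *)

Section EllipsoidBound.
Variables (R : realType) (N : nat) (sigma : 'M[R]_N -> 'M[R]_N).
Hypotheses (N0 : (1 <= N)%N) (aff : affine_on sigma).
Hypothesis ell : forall G, elliptope G -> elliptope (sigma G).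

Lemma edge_img_sym i j : (edge_img sigma i j)^T = edge_img sigma i j.
Proof.
have e1 := ell (@elliptope1 R N); have e2 := ell (elliptope_edge1 R i j).
by rewrite linearB /=; case: e1 => -> _ _; case: e2 => -> _ _.
Qed.

Lemma edge_img_diag i j a : edge_img sigma i j a a = 0.
Proof.
have e1 := ell (@elliptope1 R N); have e2 := ell (elliptope_edge1 R i j).
by rewrite !mxE; case: e1 => _ _ ->; case: e2 => _ _ ->; rewrite subrr.
Qed.

(** The coefficient matrix of the affine function [G -> sigma G k l]: the family [edge_img] read
    with the target entry fixed. *)
Definition coedge_img k l : 'M[R]_N := \matrix_(i, j) edge_img sigma i j k l.

Lemma coedge_imgE k l i j : coedge_img k l i j = edge_img sigma i j k l.
Proof. by rewrite [LHS]mxE. Qed.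

Lemma coedge_img_sym k l : (coedge_img k l)^T = coedge_img k l.
Proof. by apply/matrixP=> i j; rewrite mxE !coedge_imgE edge_imgC. Qed.

Lemma coedge_img_diag k l i : coedge_img k l i i = 0.
Proof. by rewrite coedge_imgE edge_imgii mxE. Qed.

Lemma affine_on_entry G k l : elliptope G -> sigma G k l =
  sigma 1%:M k l + 2^-1 * \sum_i \sum_j G i j * edge_img sigma i j k l.
Proof.
move=> eG; rewrite affine_on_edges // !mxE summxE; congr (_ + _ * _).
apply: eq_bigr => i _; rewrite summxE; apply: eq_bigr => j _.
by rewrite mxE.
Qed.

Lemma affine_on_cut x k l : sigma (cut_mx R x) k l =
  sigma 1%:M k l + 2^-1 * qform (coedge_img k l) (sgv R x).
Proof.
rewrite affine_on_entry; last exact: elliptope_cut.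
congr (_ + _ * _); apply: eq_bigr => i _; rewrite mulr_sumr.
by apply: eq_bigr => j _; rewrite mxE coedge_imgE; ring.
Qed.

(* Average of [sigma(x x^T)_kl ^ 2 <= 1] over all sign vectors [x]. *)
Lemma edge_img_bound k l :
  sigma 1%:M k l ^+ 2 + 2^-1 * \sum_i \sum_j edge_img sigma i j k l ^+ 2 <= 1.
Proof.
set C : R := #|{: {ffun 'I_N -> bool}}|%:R.
have C0 : 0 < C.
  by rewrite ltr0n; apply/card_gt0P; exists [ffun=> false].
rewrite -(ler_pM2l C0) mulr1.
have -> : C * (sigma 1%:M k l ^+ 2 +
     2^-1 * \sum_i \sum_j edge_img sigma i j k l ^+ 2) =
   \sum_(x : {ffun 'I_N -> bool}) sigma (cut_mx R x) k l ^+ 2.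
  pose q x := qform (coedge_img k l) (sgv R x).
  transitivity (\sum_x (sigma 1%:M k l ^+ 2 + sigma 1%:M k l * q x
      + 4^-1 * q x ^+ 2)); last first.
    by apply: eq_bigr => x _; rewrite affine_on_cut -/(q x); field.
  rewrite !big_split /= -!mulr_sumr sum_qform_sgv; last exact: coedge_img_diag.
  rewrite (sum_qform_sgv_sqr (coedge_img_sym k l) (coedge_img_diag k l)).
  rewrite sumr_const -mulr_natl -/C.
  have -> : \sum_i \sum_j coedge_img k l i j ^+ 2 =
     \sum_i \sum_j edge_img sigma i j k l ^+ 2.
    by apply: eq_bigr => i _; apply: eq_bigr => j _; rewrite coedge_imgE.
  by field.
rewrite /C -sumr_const; apply: ler_sum => x _.
by apply: elliptope_entry_sqr; apply: ell; apply: elliptope_cut.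
Qed.

(** The factor [(k != l)%:R] makes the summed bound agree exactly with the trace obtained from
    [edge_img_dual]. *)
Lemma edge_img_sum_le k l :
  \sum_i \sum_j edge_img sigma i j k l ^+ 2 <= 2 * (k != l)%:R.
Proof.
have [<-|nkl] := eqVneq k l; last first.
  have := edge_img_bound k l; have := sqr_ge0 (sigma 1%:M k l).
  set X := \sum_i _; set Y := _ ^+ 2; rewrite mulr1; lra.
rewrite mulr0 big1 // => i _; rewrite big1 // => j _.
by rewrite edge_img_diag expr0n.
Qed.

End EllipsoidBound.

(** * Orthogonality of the linear part *)

(** Deliberately one-sided: the properties of [tau] come from the mirrored instance, so each lemma
    can be reused with the roles exchanged. *)
Definition inverse_on (R : realType) (N : nat)
    (sigma tau : 'M[R]_N -> 'M[R]_N) :=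
  [/\ affine_on sigma, forall G, elliptope G -> elliptope (sigma G)
    & forall G, elliptope G -> tau (sigma G) = G].

Section Orthogonality.
Variables (R : realType) (N : nat) (sigma tau : 'M[R]_N -> 'M[R]_N).
Hypotheses (N0 : (1 <= N)%N).
Hypotheses (st : inverse_on sigma tau) (ts : inverse_on tau sigma).
Local Notation K := (edge_img sigma).
Local Notation K' := (edge_img tau).

(** A diagonal entry of the identity [K'K = 1]: expand [tau] at the images of [1%:M + edge_mx R i j]
    and of [1%:M], and subtract. *)
Lemma edge_img_dual i j :
  \sum_k \sum_l K i j k l * K' k l i j = 2 * (i != j)%:R.
Proof.
have [affs ells stK] := st; have [afft ellt _] := ts.
have eE := elliptope_edge1 R i j.
have e1 := @elliptope1 R N.
have := affine_on_entry N0 afft i j (ells _ eE); rewrite stK //.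
have := affine_on_entry N0 afft i j (ells _ e1); rewrite stK //.
have -> : \sum_k \sum_l K i j k l * K' k l i j =
  \sum_k \sum_l sigma (1%:M + edge_mx R i j) k l * K' k l i j -
  \sum_k \sum_l sigma 1%:M k l * K' k l i j.
  rewrite -sumrB; apply: eq_bigr => k _; rewrite -sumrB.
  by apply: eq_bigr => l _; rewrite -mulrBl !mxE.
set A := \sum_k _; set B := \sum_k _; rewrite !mxE.
case: (eqVneq i j) => [->|nij] /=; rewrite ?eqxx /=; lra.
Qed.

(* [|K - K'^T|^2 = |K|^2 + |K'|^2 - 2 tr(K K') <= 0] *)
Lemma edge_img_adjoint i j k l : K i j k l = K' k l i j.
Proof.
have [affs ells stK] := st; have [afft ellt _] := ts.
pose D i j k l := (K i j k l - K' k l i j) ^+ 2.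
have D0 i' j' k' l' : 0 <= D i' j' k' l' by apply: sqr_ge0.
pose n : R := \sum_(i < N) \sum_(j < N) (i != j)%:R.
have le1 : \sum_i \sum_j \sum_k \sum_l K i j k l ^+ 2 <= 2 * n.
  have -> : \sum_i \sum_j \sum_k \sum_l K i j k l ^+ 2 =
            \sum_k \sum_l \sum_i \sum_j K i j k l ^+ 2.
    rewrite pair_big [RHS]pair_big /=.
    under eq_bigr do rewrite pair_big /=.
    under [RHS]eq_bigr do rewrite pair_big /=.
    exact: exchange_big.
  rewrite mulr_sumr; apply: ler_sum => k' _; rewrite mulr_sumr.
  by apply: ler_sum => l' _; apply: edge_img_sum_le.
have le2 : \sum_i \sum_j \sum_k \sum_l K' k l i j ^+ 2 <= 2 * n.
  rewrite mulr_sumr; apply: ler_sum => k' _; rewrite mulr_sumr.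
  by apply: ler_sum => l' _; apply: edge_img_sum_le.
have eq3 : \sum_i \sum_j \sum_k \sum_l K i j k l * K' k l i j = 2 * n.
  rewrite mulr_sumr; apply: eq_bigr => k' _; rewrite mulr_sumr.
  by apply: eq_bigr => l' _; apply: edge_img_dual.
have : \sum_i \sum_j \sum_k \sum_l D i j k l <= 0.
  have -> : \sum_i \sum_j \sum_k \sum_l D i j k l =
     \sum_i \sum_j \sum_k \sum_l K i j k l ^+ 2 +
     \sum_i \sum_j \sum_k \sum_l K' k l i j ^+ 2 -
     2 * \sum_i \sum_j \sum_k \sum_l K i j k l * K' k l i j.
    do 4 (rewrite mulr_sumr -big_split -sumrB; apply: eq_bigr => ? _ /=).
    rewrite /D; ring.
  lra.
move=> le0; apply/eqP; rewrite -subr_eq0 -sqrf_eq0 -/(D i j k l).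
rewrite eq_le D0 andbT; apply: le_trans le0.
rewrite (bigD1 i) //= (bigD1 j) //= (bigD1 k) //= (bigD1 l) //=.
by rewrite -!addrA lerDl !addr_ge0 //; do !apply: sumr_ge0 => ? _.
Qed.

End Orthogonality.

(** Adjointness turns the pairing of [edge_img_dual] into a squared norm. *)
Lemma edge_img_norm (R : realType) (N : nat)
    (sigma tau : 'M[R]_N -> 'M[R]_N) i j :
  (1 <= N)%N -> inverse_on sigma tau -> inverse_on tau sigma ->
  \sum_k \sum_l edge_img sigma i j k l ^+ 2 = 2 * (i != j)%:R.
Proof.
move=> N0 st ts; rewrite -(edge_img_dual N0 st ts); apply: eq_bigr => k _.
by apply: eq_bigr => l _; rewrite -(edge_img_adjoint N0 st ts).
Qed.

(** * Images of edges *)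

Section Edges.
Variables (R : realType) (N : nat) (sigma tau : 'M[R]_N -> 'M[R]_N).
Hypotheses (N0 : (1 <= N)%N).
Hypotheses (st : inverse_on sigma tau) (ts : inverse_on tau sigma).
Local Notation K := (edge_img sigma).

(** For [k != l] the norm term exhausts the bound 1 in [edge_img_bound], leaving no room for
    [sigma 1%:M k l]. *)
Lemma fixes_identity : sigma 1%:M = 1%:M.
Proof.
have [affs ells _] := st; have [_ _ diag1] := ells _ (@elliptope1 R N).
apply/matrixP=> k l; rewrite [RHS]mxE.
have [<-|nkl] := eqVneq k l; first exact: diag1.
have := edge_img_bound N0 affs ells k l.
have -> : \sum_i \sum_j K i j k l ^+ 2 = 2.
  have := edge_img_norm k l N0 ts st; rewrite nkl mulr1 => <-.
  apply: eq_bigr => i _; apply: eq_bigr => j _.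
  by rewrite (edge_img_adjoint N0 st ts).
rewrite mulVf ?pnatr_eq0 // gerDr => le0; apply/eqP; rewrite -sqrf_eq0.
by rewrite eq_le le0 sqr_ge0.
Qed.


Lemma inverse_fixes_identity : tau 1%:M = 1%:M.
Proof.
have [_ _ stK] := st; rewrite -[in LHS]fixes_identity stK //; exact: elliptope1.
Qed.

(** The linear part is orthogonal and the identity is fixed, so the Frobenius inner product is
    preserved. *)
Lemma sum_entries_isometry G H : elliptope G -> elliptope H ->
  \sum_k \sum_l sigma G k l * sigma H k l = \sum_i \sum_j G i j * H i j.
Proof.
move=> eG eH; have [affs ells stK] := st; have [afft ellt _] := ts.
pose S (A B : 'M[R]_N) := \sum_k \sum_l A k l * B k l.
have S1 A : elliptope A -> S 1%:M A = N%:R.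
  case=> _ _ diagA; rewrite -[N in RHS]card_ord -sumr_const.
  apply: eq_bigr => k _.
  rewrite (bigD1 k) //= mxE eqxx mul1r diagA big1 ?addr0 // => l nlk.
  by rewrite mxE eq_sym (negPf nlk) mul0r.
have tauE i j : 2^-1 * \sum_k \sum_l K i j k l * sigma H k l =
    H i j - (1%:M : 'M[R]_N) i j.
  have := affine_on_entry N0 afft i j (ells _ eH).
  rewrite stK // inverse_fixes_identity => ->.
  rewrite [in RHS]addrC addKr; congr (_ * _).
  apply: eq_bigr => k _; apply: eq_bigr => l _.
  by rewrite (edge_img_adjoint N0 st ts) mulrC.
have -> : \sum_k \sum_l sigma G k l * sigma H k l =
  S 1%:M (sigma H) + \sum_i \sum_j G i j *
     (2^-1 * \sum_k \sum_l K i j k l * sigma H k l).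
  transitivity (\sum_k \sum_l ((1%:M : 'M[R]_N) k l * sigma H k l +
    \sum_i \sum_j G i j * (2^-1 * (K i j k l * sigma H k l)))).
    apply: eq_bigr => k _; apply: eq_bigr => l _.
    rewrite (affine_on_entry N0 affs) // fixes_identity mulrDl; congr (_ + _).
    rewrite mulr_sumr mulr_suml; apply: eq_bigr => i _.
    rewrite mulr_sumr mulr_suml; apply: eq_bigr => j _; ring.
  under eq_bigr => k _ do rewrite big_split /=.
  rewrite big_split /=; congr (_ + _).
  rewrite pair_big [RHS]pair_big /=.
  under eq_bigr do rewrite pair_big /=.
  rewrite exchange_big; apply: eq_bigr => p _ /=.
  by rewrite pair_big /= -!mulr_sumr.
under eq_bigr => i _ do under eq_bigr => j _ do rewrite tauE mulrBr.
under eq_bigr => i _ do rewrite sumrB.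
(* What remains compares the traces of [sigma H] and [G], both equal to [N]. *)
rewrite sumrB S1; last exact: ells.
have := S1 _ eG; set X := S _ _.
have -> : X = \sum_i \sum_j G i j * (1%:M : 'M[R]_N) i j.
  by apply: eq_bigr => i _; apply: eq_bigr => j _; rewrite mulrC.
by move=> ->; rewrite addrC subrK.
Qed.

(** By adjointness [K i j] is the coefficient matrix of entry [(i, j)] of [tau]. *)
Lemma qform_edge_img i j x : i != j ->
  qform (K i j) (sgv R x) = 2 * tau (cut_mx R x) i j.
Proof.
move=> nij; have [_ _ stK] := st; have [afft _ _] := ts.
rewrite affine_on_cut // inverse_fixes_identity mxE (negPf nij) add0r.
rewrite mulVKf ?pnatr_eq0 //.
apply: eq_bigr => k _; congr (_ * _); apply: eq_bigr => l _.
by rewrite coedge_imgE (edge_img_adjoint N0 st ts).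
Qed.

(* [x^T K_ij x] is bounded by [2] and has quadratic mean [2]. *)
Lemma qform_edge_img_sqr i j x : i != j -> qform (K i j) (sgv R x) ^+ 2 = 4.
Proof.
move=> nij; have [_ ells _] := st; have [_ ellt _] := ts.
pose f x : R := 4 - qform (K i j) (sgv R x) ^+ 2.
have f0 y : 0 <= f y.
  rewrite /f qform_edge_img // exprMn.
  have := elliptope_entry_sqr i j (ellt _ (elliptope_cut R y)); lra.
have : \sum_y f y = 0.
  rewrite sumrB sumr_const (sum_qform_sgv_sqr (edge_img_sym ells i j)).
    rewrite (edge_img_norm _ _ N0 st ts) nij mulr1 -[_ *+ #|_|]mulr_natr; ring.
  by move=> a; apply: edge_img_diag.
move/psumr_eq0P => /(_ (fun y _ => f0 y)) /(_ x isT) /eqP.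
by rewrite subr_eq0 => /eqP.
Qed.

Lemma edge_img_edge i j : i != j ->
  exists k l, exists2 s : R, k != l & s ^+ 2 = 1 /\ K i j = s *: edge_mx R k l.
Proof.
move=> nij; have [_ ells stK] := st; have [afft ellt tsK] := ts.
have symK := edge_img_sym ells i j; have diagK := edge_img_diag ells i j.
have orthoK a b : a != b -> \sum_c K i j a c * K i j b c = 0.
  by apply: rows_orthogonal => // x; apply: qform_edge_img_sqr.
have [/existsP[k rowk]|] := boolP [exists k, 1 <= \sum_l K i j k l ^+ 2].
  exists k; apply: edge_of_orthogonal_rows => //.
  by rewrite (edge_img_norm _ _ N0 st ts) nij mulr1.
move=> /existsPn rows.
have [|t t1 et] := elliptope_dilation symK diagK orthoK.
  by move=> k; rewrite ltNge.
(* By [edge_img_dual], the preimage of [1%:M + t *: K i j] has entry [t > 1] at [(i, j)], which is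
   impossible. *)
have := elliptope_entry i j (ellt _ et).
rewrite (affine_on_entry N0 afft) // inverse_fixes_identity.
rewrite mxE (negPf nij) add0r.
have -> : \sum_k \sum_l (1%:M + t *: K i j) k l * edge_img tau k l i j =
   t * \sum_k \sum_l K i j k l * edge_img tau k l i j.
  rewrite mulr_sumr; apply: eq_bigr => k _; rewrite mulr_sumr.
  apply: eq_bigr => l _; have [->|nkl] := eqVneq k l.
    have -> : edge_img tau l l i j = 0 by rewrite edge_imgii mxE.
    by rewrite !mulr0.
  rewrite [X in X * _]mxE [X in X + _]mxE [X in _ + X]mxE.
  by rewrite (negPf nkl) add0r mulrA.
rewrite (edge_img_dual N0 st ts) nij mulr1; lra.
Qed.

End Edges.

(** * Images of cut matrices *)

Section Cuts.
Variables (R : realType) (N : nat) (sigma tau : 'M[R]_N -> 'M[R]_N).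
Hypotheses (N0 : (1 <= N)%N).
Hypotheses (st : inverse_on sigma tau) (ts : inverse_on tau sigma).

Lemma qform_edge (s : R) k l (u : 'I_N -> R) : k != l ->
  qform (s *: edge_mx R k l) u = 2 * (s * u k * u l).
Proof.
move=> nkl; rewrite /qform.
under eq_bigr => a _ do rewrite mxapp_edge // mulrDr mulrDr !mulrA.
rewrite big_split /= !sum_delta; ring.
Qed.

(** With [sigma] and [tau] exchanged, [qform_edge_img_sqr] says that the off-diagonal entries of the
    image square to 1. *)
Lemma cut_image x : exists y, sigma (cut_mx R x) = cut_mx R y.
Proof.
have [affs ells stK] := st.
have ex := ells _ (elliptope_cut R x).
apply: (cut_of_signs (Ordinal N0) ex) => k l.
have [<-|nkl] := eqVneq k l; first by case: ex => _ _ ->; rewrite expr1n.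
have := qform_edge_img_sqr N0 ts st x nkl.
by rewrite (qform_edge_img N0 ts st) // exprMn; lra.
Qed.

End Cuts.

(** * The vertex map and the switching *)

Section Structure.
Variables (R : realType) (N : nat) (sigma tau : 'M[R]_N -> 'M[R]_N).
Hypotheses (N0 : (1 <= N)%N).
Hypotheses (st : inverse_on sigma tau) (ts : inverse_on tau sigma).
Local Notation K := (edge_img sigma).
Local Notation cube := {ffun 'I_N -> bool}.
Local Notation ones := ([ffun=> false] : cube).

Definition star a : cube := [ffun k => k == a].

(** Evaluate [K i j] at the sign vector of the image cut: the image at [(k, l)] determines the
    original cut at [(i, j)]. *)
Lemma edge_sign (s : R) i j k l x : i != j -> k != l ->
  K i j = s *: edge_mx R k l -> s * sigma (cut_mx R x) k l = cut_mx R x i j.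
Proof.
move=> nij nkl Kij; have [_ _ stK] := st; have [y sx] := cut_image N0 st ts x.
have := qform_edge_img N0 st ts y nij.
rewrite Kij qform_edge // -sx stK; last exact: elliptope_cut.
by move/(mulfI (_ : 2 != 0 :> R)) <-; rewrite ?pnatr_eq0 // sx mxE mulrA.
Qed.

Lemma sgv_star a k : sgv R (star a) k = 1 - 2 * (k == a)%:R.
Proof.
by rewrite /sgv ffunE; case: (k == a); rewrite ?expr1 ?expr0 /=; ring.
Qed.

(* By the isometry, the sign vector [z] of the image of the star cut satisfies
   [(sum_k y_k z_k)^2 = (N - 2)^2]. *)
Lemma star_image (y : cube) a : sigma (cut_mx R ones) = cut_mx R y ->
  exists p, forall k l, sigma (cut_mx R (star a)) k l =
    sgv R y k * sgv R y l * (sgv R (star p) k * sgv R (star p) l).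
Proof.
move=> sy; have [z sz] := cut_image N0 st ts (star a).
have := sum_entries_isometry N0 st ts (elliptope_cut R ones)
  (elliptope_cut R (star a)).
rewrite sy sz !sum_cut_mx => /eqP.
have -> : \sum_k sgv R ones k * sgv R (star a) k = N%:R - 2.
  under eq_bigr => k _ do rewrite sgv_star {1}/sgv ffunE expr0 mul1r.
  by rewrite sumrB sumr_const card_ord (sum_delta (fun=> 2) a).
rewrite eqf_sqr => sum_yz.
(* [e] absorbs the sign left open by the square root. The terms are then 0 or 2 with sum 2, so
   exactly one of them is nonzero, and its index is [p]. *)
have [e e2 sumv] : exists2 e : R, e ^+ 2 = 1 &
    \sum_k (1 - e * (sgv R y k * sgv R z k)) = 2.
  have [/eqP E|/eqP E] := orP sum_yz; [exists 1 | exists (-1)];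
    rewrite ?sqrrN ?expr1n // sumrB sumr_const card_ord -mulr_sumr E; ring.
pose v k := e * (sgv R y k * sgv R z k).
have {}sumv : \sum_k (1 - v k) = 2 by [].
have v2 k : v k ^+ 2 = 1 by rewrite !exprMn e2 !sgv_sqr !mulr1.
have vle k : 0 <= 1 - v k by have := v2 k; nra.
have [p vp] : exists p, v p != 1.
  apply/existsP; apply: contra_eqT sumv => /existsPn v1.
  rewrite big1 1?eq_sym ?pnatr_eq0 // => k _.
  by have := v1 k; rewrite negbK => /eqP->; rewrite subrr.
have {}vp : v p = -1.
  by have /eqP := v2 p; rewrite sqrf_eq1 (negPf vp) => /eqP.
have vE k : v k = sgv R (star p) k.
  rewrite sgv_star; have [->|kp] := eqVneq k p; first by rewrite vp mulr1; ring.
  move: sumv; rewrite (bigD1 p) //= vp => sumv.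
  have : \sum_(i | i != p) (1 - v i) = 0 by lra.
  move/psumr_eq0P => /(_ (fun i _ => vle i)) /(_ k kp); rewrite mulr0; lra.
exists p => k l; rewrite mxE -!vE /v.
have yk := sgv_sqr R y k; have yl := sgv_sqr R y l.
ring: e2 yk yl.
Qed.

(** The all-ones cut fixes the sign of each image edge; the star cuts show which vertices map into
    it. *)
Lemma edges_permuted : exists y : cube, exists2 p : 'I_N -> 'I_N, injective p &
  forall i j, K i j = (sgv R y (p i) * sgv R y (p j)) *: edge_mx R (p i) (p j).
Proof.
have [y sy] := cut_image N0 st ts ones; exists y.
have /fin_all_exists[p pP] := fun a => star_image a sy.
have edgeP i j : i != j -> exists k l, [/\ k != l,
    K i j = (sgv R y k * sgv R y l) *: edge_mx R k l &
    forall a, (p a \in [:: k; l]) = (a \in [:: i; j])].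
  move=> nij; have [k [l [s nkl [s2 Kij]]]] := edge_img_edge N0 st ts nij.
  have s1 : s * (sgv R y k * sgv R y l) = 1.
    have := edge_sign ones nij nkl Kij; rewrite sy !mxE => ->.
    by rewrite /sgv !ffunE expr0 mulr1.
  exists k, l; split=> // [|a].
    have yk := sgv_sqr R y k; have yl := sgv_sqr R y l.
    rewrite Kij; congr (_ *: _); rewrite -[RHS]mul1r -s1; ring: yk yl.
  (* The star at [p a] separates [k] from [l] exactly when the star at [a] separates [i] from
     [j]. *)
  have := edge_sign (star a) nij nkl Kij; rewrite pP mulrA s1.
  rewrite mul1r mxE !sgv_star !inE ![p a == _]eq_sym ![a == _]eq_sym.
  have excl (b c d : 'I_N) : b != c -> ~~ ((b == d) && (c == d)).
    by apply: contraNN => /andP[/eqP-> /eqP->].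
  move: (excl _ _ (p a) nkl) (excl _ _ a nij).
  case: (k == p a); case: (l == p a); case: (i == a); case: (j == a) => //= _ _;
    rewrite !(mulr0, mulr1); lra.
have [/injectiveP injp|ninj] := boolP (injectiveb p).
  exists p => // i j; have [->|nij] := eqVneq i j.
    by rewrite edge_imgii edge_mxii scaler0.
  have [k [l [nkl -> pE]]] := edgeP i j nij.
  have := pE i; have := pE j; rewrite !inE !eqxx orbT /=.
  have npij : p i != p j by rewrite (inj_eq injp).
  move=> /orP[]/eqP pj /orP[]/eqP pi; move: npij; rewrite pi pj ?eqxx // => _.
  by rewrite edge_mxC mulrC.
(* For [N = 2] the stars at the two vertices are the same cut, so the chosen [p] may fail to be
   injective. *)
have /injectivePn[a [b nab pab]] := ninj.
(* A vertex [c] outside [{a, b}] would give an edge [{a, c}] whose image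
   contains [p a = p b], so [N = 2] and there is only one edge. *)
have abE c : (c == a) || (c == b).
  have [//|nca] := eqVneq c a; have [//|ncb] := eqVneq c b.
  have nac : a != c by rewrite eq_sym.
  have [k [l [_ _ pE]]] := edgeP a c nac.
  have := pE a; have := pE b; rewrite -pab => ->.
  by rewrite !inE eqxx eq_sym (negPf nab) eq_sym (negPf ncb).
(* With only two vertices the single edge is mapped to itself up to sign, so the identity serves as
   vertex map. *)
exists id => // i j; have [->|nij] := eqVneq i j.
  by rewrite edge_imgii edge_mxii scaler0.
have [k [l [nkl -> _]]] := edgeP i j nij.
have := abE i; have := abE j; have := abE k; have := abE l.
move=> /orP[]/eqP le /orP[]/eqP ke /orP[]/eqP je /orP[]/eqP ie; subst;
  move: nij nkl; rewrite ?eqxx // => _ _; by rewrite edge_mxC mulrC.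
Qed.

End Structure.

(** * Entries of the generators and conclusion *)

(** The permutation matrix is orthogonal, so its inverse is its transpose. *)
Lemma PimapE (R : realType) (N : nat) (pi : 'S_N) (G : 'M[R]_N) mu nu :
  Pimap pi G mu nu = G (pi mu) (pi nu).
Proof.
have UTU : (Umx R pi)^T *m Umx R pi = 1%:M.
  apply/matrixP=> a b; rewrite !mxE eq_sym -(inj_eq (@perm_inj _ pi)).
  rewrite -(sum_delta (fun j => (j == pi a)%:R) (pi b)).
  by apply: eq_bigr => j _; rewrite !mxE.
have [_ uU] := mulmx1_unit UTU.
have -> : Pimap pi G = (Umx R pi)^T *m G *m Umx R pi.
  by congr (_ *m _ *m _); rewrite -[LHS]mul1mx -UTU mulmxK.
rewrite mxE -(sum_delta (G (pi mu)) (pi nu)); apply: eq_bigr => j _.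
rewrite !mxE; congr (_ * _).
rewrite -(sum_delta (fun i => G i j) (pi mu)); apply: eq_bigr => i _.
by rewrite !mxE mulrC.
Qed.

Lemma RmapE (R : realType) (N : nat) (x : {ffun 'I_N -> bool})
    (G : 'M[R]_N) mu nu :
  Rmap [set i | x i] G mu nu = sgv R x mu * sgv R x nu * G mu nu.
Proof.
have VE a b : Vmx R [set i | x i] a b = sgv R x a * (a == b)%:R.
  rewrite mxE inE /sgv; case: (a == b); last by rewrite mulr0.
  by rewrite mulr1; case: (x a).
rewrite mxE -[RHS](sum_delta (fun j => sgv R x mu * sgv R x j * G mu j) nu).
apply: eq_bigr => j _; rewrite VE mxE.
suff -> : \sum_k Vmx R [set i | x i] mu k * G k j = sgv R x mu * G mu j.
  by ring.
rewrite -(sum_delta (fun k => sgv R x mu * G k j) mu); apply: eq_bigr => k _.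
by rewrite VE eq_sym; ring.
Qed.

(** The inverse is chosen pointwise; its affinity follows from that of [sigma] by injectivity. *)
Lemma bijection_on_inverse (R : realType) (N : nat)
    (sigma : 'M[R]_N -> 'M[R]_N) :
  affine_on sigma -> bijection_on sigma ->
  exists tau, inverse_on sigma tau /\ inverse_on tau sigma.
Proof.
move=> aff [ell inj surj].
have /choice[tau tauP] : forall H, exists G,
    elliptope H -> elliptope G /\ sigma G = H.
  (* Outside the elliptope [H] itself is an arbitrary default value. *)
  move=> H; have [/surj[G eG sG]|nH] := EM (elliptope H); first by exists G.
  by exists H.
have ellt H : elliptope H -> elliptope (tau H) by move/tauP => [].
have tK H : elliptope H -> sigma (tau H) = H by move/tauP => [].
have stK G : elliptope G -> tau (sigma G) = G.
  by move=> eG; apply: inj => //; [apply/ellt/ell | apply/tK/ell].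
exists tau; split; split=> // G1 G2 t e1 e2 t0 t1.
have [f1 f2] := (ellt _ e1, ellt _ e2).
apply: inj; [exact/ellt/elliptope_conv | exact: elliptope_conv |].
by rewrite aff ?tK //; apply: elliptope_conv.
Qed.

Theorem theorem4 (R : realType) (N : nat) (hN : (1 <= N)%N)
    (sigma : 'M[R]_N -> 'M[R]_N) :
  affine_on sigma -> bijection_on sigma ->
  exists2 tau, in_Sym tau & forall G, elliptope G -> sigma G = tau G.
Proof.
move=> aff bij; have [tau [st ts]] := bijection_on_inverse aff bij.
have [y [p injp Kp]] := edges_permuted hN st ts.
(* The inverse appears because [Pimap] pulls indices back, whereas [p] pushes edges forward. *)
pose q := (perm injp)^-1%g.
have pq i : p (q i) = i by rewrite -(permE injp) permKV.
have qp i : q (p i) = i by rewrite -(permE injp) permK.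
exists (Rmap [set i | y i] \o Pimap q).
  by apply: Sym_comp; [apply: Sym_R | apply: Sym_Pi].
move=> G eG; have [_ ell _] := st; have [symG _ diagG] := eG.
apply/matrixP=> a b; rewrite /= RmapE PimapE.
have [<-|nab] := eqVneq a b.
  by have [_ _ ->] := ell _ eG; rewrite -expr2 sgv_sqr diagG mulr1.
rewrite (affine_on_entry hN aff) // (fixes_identity hN st ts).
rewrite mxE (negPf nab) add0r.
(* [H] is the expected image; reindexing along [p] turns the expansion of [sigma G] into its edge
   expansion. *)
pose H : 'M[R]_N := \matrix_(i, j) (sgv R y i * sgv R y j * G (q i) (q j)).
have symH : H^T = H.
  apply/matrixP=> i j; rewrite !mxE -[in LHS]symG mxE; ring.
apply: (canLR (mulKf _)); first by rewrite pnatr_eq0.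
transitivity (2 * H a b); last by rewrite mxE.
rewrite -(sum_edge_mx symH nab) [RHS](reindex_inj injp) /=.
apply: eq_bigr => i _; rewrite [RHS](reindex_inj injp) /=.
by apply: eq_bigr => j _; rewrite Kp mxE [H _ _]mxE !qp; ring.
Qed.
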